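(* Let the time mesh be uniform (with step $\rho=\tau/(2N)$), and let $u_h^n\in X_h$, $1\le n\le 2KN$, be the solution of the fully discrete finite element scheme $$(D^\alpha u_h^n,v_h)+B(u_h^n,v_h)=(bJ^{1-\alpha}u_h^{n-2N},v_h)+(G^n,v_h)\quad\forall v_h\in X_h,$$ with $u_h^{n-2N}=\varphi_h^{n-2N}\in X_h$ for $1\le n\le 2N$. Then, for $1\le n\le 2KN$, $$\|u_h^n\|\lesssim\left(\|u_h^0\|+\rho|b|\sum_{k=1}^{2N}\|\varphi_h^{k-2N}\|+\frac{t_n^\alpha}{\Gamma(1+\alpha)}\max_{1\le j\le n}\|G^j\|\right).$$
   Context: The scheme approximates the delay subdiffusion problem ${}_0^C\mathrm D_t^\alpha u=p\Delta u+au+{}_0I_t^{1-\alpha}[bu(x,t-\tau)]+G$ on $\Omega_T=(0,L)\times(0,K\tau]$, with $u=\varphi$ on $\Omega\times[-\tau,0]$ and zero Dirichlet boundary values, where $0<\alpha<1$, $\tau>0$, $K\in\mathbb N^+$, $p>0$, $a\le0$, $b\ne0$ are constants, $\Omega=(0,L)$, $G={}_0I_t^{1-\alpha}f$ with $f$ and $\varphi$ continuous. Here $\omega_\beta(t)=t^{\beta-1}/\Gamma(\beta)$, ${}_0I_t^{\beta}v(t)=\int_0^t\omega_\beta(t-s)v(s)\,ds$, and ${}_0^C\mathrm D_t^\alpha u(x,t)=\int_0^t\omega_{1-\alpha}(t-s)\partial_su(x,s)\,ds$. Uniform mesh: $N\ge2$ an integer, $\rho=\tau/(2N)$, $t_n=n\rho$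 for $-2N\le n\le 2KN$. Put $\nabla_tv^n=v^n-v^{n-1}$, $G^n=G(\cdot,t_n)$, $$a_{n-k}=\frac{\omega_{2-\alpha}(t_n-t_{k-1})-\omega_{2-\alpha}(t_n-t_k)}{\rho},\qquad D^\alpha v^n=\sum_{k=1}^na_{n-k}\nabla_tv^k,\qquad J^{1-\alpha}v^{n-2N}=\sum_{k=1}^n\rho\,a_{n-k}v^{k-2N}.$$ $X_h\subset H_0^1(\Omega)$ is the continuous piecewise linear finite element space on a quasi-uniform mesh of $\Omega$ with maximal diameter $h$; $(u,v)=\int_\Omega uv\,dx$, $\|u\|=(u,u)^{1/2}$, $B(u,v)=p\left(\frac{du}{dx},\frac{dv}{dx}\right)-(au,v)$. $\varphi_h^{n-2N}$ is a suitable approximation in $X_h$ of $\varphi(\cdot,t_{n-2N})$ (so $u_h^0=\varphi_h^0$). $A\lesssim B$ means $A\le CB$ with a constant $C>0$ independent of $N$, $h$, $n$ and of the discrete data $\varphi_h^{k}$, $G^j$. *)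

(* Defs.v *)
From HB Require Import structures.
From mathcomp Require Import all_boot all_order all_algebra.
From mathcomp Require Import all_classical all_reals all_analysis.
Set Implicit Arguments.
Unset Strict Implicit.
Unset Printing Implicit Defensive.
Import Order.TTheory GRing.Theory Num.Theory.
Import numFieldNormedType.Exports.
Local Open Scope classical_set_scope.
Local Open Scope ring_scope.

Section FractionalCalculus.
Variable R : realType.
Local Notation mu := (@lebesgue_measure R).
Implicit Types (beta t : R) (v : R -> R).

(* Euler's integral; it is finite (hence meaningful) only for [0 < beta]. *)
Definition Gamma beta : R :=
  \int[mu]_(s in `]0, +oo[) (s `^ (beta - 1) * expR (- s)).

(* [0 `^ r = 0] for [r != 0], so [omega beta 0 = 0] for [beta != 1]: this is
   the continuous value when [1 < beta], and an irrelevant one when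
   [beta < 1], where [omega beta] is only used under an integral. *)
Definition omega beta t : R := t `^ (beta - 1) / Gamma beta.

Definition frac_int beta v t : R :=
  \int[mu]_(s in `]0, t[) (omega beta (t - s) * v s).

(* G(., t), as a function of space, for G = I^{1-alpha} f; here
   [f y s] is f at the space point [y] and time [s]. *)
Definition source (alpha : R) (f : R -> R -> R) t : R -> R :=
  fun y => frac_int (1 - alpha) (f y) t.

End FractionalCalculus.

Section SpaceDiscretization.
Variable R : realType.
Local Notation mu := (@lebesgue_measure R).
Implicit Types (L : R) (v w : R -> R).

Definition inner L v w : R := \int[mu]_(y in `]0, L[) (v y * w y).

Definition l2norm L v : R := Num.sqrt (inner L v v).

(* Nodes 0 = x 0 < x 1 < ... < x M = L; the values [x i] with [M < i] are
   irrelevant. *)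
Definition is_mesh L (M : nat) (x : nat -> R) : Prop :=
  [/\ (0 < M)%N, x 0%N = 0, x M = L &
      forall i, (i < M)%N -> x i < x i.+1].

Definition mesh_size (M : nat) (x : nat -> R) : R :=
  \big[Num.max/0]_(0 <= i < M) (x i.+1 - x i).

Definition quasi_uniform (sigma : R) (M : nat) (x : nat -> R) : Prop :=
  forall i, (i < M)%N -> mesh_size M x <= sigma * (x i.+1 - x i).

(* Continuous piecewise linear functions vanishing at 0 and L. Functions are
   total on R, but only their values on [0, L] matter. *)
Definition fe_space L (M : nat) (x : nat -> R) : set (R -> R) :=
  [set v | [/\ {within `[0, L], continuous v}, v 0 = 0, v L = 0 &
    forall i, (i < M)%N ->
      exists c d : R, forall y, y \in `[x i, x i.+1] -> v y = c * y + d]].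

(* For [v] in [fe_space], the pointwise derivative [derive1 v] exists in the
   interior of each mesh cell and is there the weak derivative of [v]; the
   value it takes at the nodes does not affect the integrals. *)
Definition bilin L (p a : R) v w : R :=
  p * inner L (derive1 v) (derive1 w) - inner L (fun y => a * v y) w.

End SpaceDiscretization.

Section TimeDiscretization.
Variable R : realType.
Implicit Types (alpha tau : R) (N n k : nat) (u : int -> R -> R).

Definition step tau N : R := tau / (2 * N)%:R.

Definition time tau N (n : int) : R := n%:~R * step tau N.

(* The coefficient written a_{n-k}: on a uniform mesh it depends on [n] and
   [k] only through their difference. *)
Definition l1coef alpha tau N n k : R :=
  (omega (2 - alpha) (time tau N n%:Z - time tau N (k%:Z - 1))
   - omega (2 - alpha) (time tau N n%:Z - time tau N k%:Z)) / step tau N.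

Definition nabla u (n : int) : R -> R := fun y => u n y - u (n - 1) y.

Definition Dalpha alpha tau N u n : R -> R :=
  fun y => \sum_(1 <= k < n.+1) l1coef alpha tau N n k * nabla u k%:Z y.

(* J^{1-alpha} u^{n-2N}, the discrete fractional integral of the delayed
   sequence. *)
Definition Jdelay alpha tau N u n : R -> R :=
  fun y => \sum_(1 <= k < n.+1)
    step tau N * l1coef alpha tau N n k * u (k%:Z - (2 * N)%:Z) y.

(* [u j] is u_h^j, for integer indices -2N < j <= 2KN. Elements of the finite
   element space are compared on [0, L] only. *)
Definition fem_solution (L alpha tau p a b : R) (K N M : nat) (x : nat -> R)
    (f : R -> R -> R) (phi u : int -> R -> R) : Prop :=
  [/\ forall n, (1 <= n <= 2 * N)%N ->
        {in `[0, L], u (n%:Z - (2 * N)%:Z) =1 phi (n%:Z - (2 * N)%:Z)},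
      forall n, (1 <= n <= 2 * K * N)%N -> fe_space L M x (u n%:Z) &
      forall n, (1 <= n <= 2 * K * N)%N ->
        forall v, fe_space L M x v ->
          inner L (Dalpha alpha tau N u n) v + bilin L p a (u n%:Z) v
          = inner L (fun y => b * Jdelay alpha tau N u n y) v
            + inner L (source alpha f (time tau N n%:Z)) v].

End TimeDiscretization.

(* Main.v *)
(* Write w_k for the L2 norm of u_h^k. Testing the scheme with v_h = u_h^n and
   using that the L1 weights a_j are positive and decreasing gives
   D^alpha w_n <= |b| J^{1-alpha} w_{n-2N} + |G^n|, that is, the discrete
   fractional derivative of z_n = w_n - w_0 - rho |b| sum_{k<=n} w_{k-2N} is at
   most |G^n|. Comparing z with the sequence equal to 0 at time 0 and to
   max_{j<=n} |G^j| / a_{n-1} at later times gives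
   z_n <= max_{j<=n} |G^j| / a_{n-1}, and concavity of t^{1-alpha} gives
   1 / a_{n-1} <= Gamma(2-alpha) / (1-alpha) t_n^alpha. This replaces the
   complementary convolution kernel, at the price of the sharp constant
   1 / Gamma(1+alpha), which is absorbed in C. The delayed sum involves w_j
   only for j < n, so the discrete Gronwall inequality concludes. *)
Require Import Defs.
From HB Require Import structures.
From mathcomp Require Import all_boot all_order all_algebra.
From mathcomp Require Import all_classical all_reals all_analysis.
From mathcomp Require Import measurable_realfun ring lra zify.
Import Order.TTheory GRing.Theory Num.Theory.
Import numFieldNormedType.Exports.
Local Open Scope classical_set_scope.
Local Open Scope ring_scope.

(** * Discrete comparison, Gronwall and Cauchy-Schwarz inequalities for real numbers *)

Section DiscreteInequalities.
Variable R : realType.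

(* Abel summation with all boundary terms but the last discarded by sign. *)
Lemma conv_diff_ge (A c : nat -> R) (n : nat) :
  (forall j, 0 <= A j) -> (forall j, A j.+1 <= A j) ->
  (forall k, (k <= n)%N -> c k <= 0) ->
  A 0%N * c n.+1 <= \sum_(0 <= k < n.+1) A (n - k)%N * (c k.+1 - c k).
Proof.
elim: n A => [|n IH] A A0 Ad c0.
  rewrite big_nat1 subnn mulrBr lerBrDl gerDr.
  by rewrite mulr_ge0_le0// c0.
rewrite big_nat_recr//= subnn.
have := IH (fun j => A j.+1) (fun j => A0 _) (fun j => Ad _)
  (fun k kn => c0 _ (leqW kn)).
rewrite [leRHS](_ : _ = \sum_(0 <= k < n.+1) A (n.+1 - k)%N * (c k.+1 - c k)).
  move=> h; apply: (le_trans _ (lerD h (lexx _))).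
  have := mulr_ge0_le0 (_ : 0 <= A 0%N - A 1%N) (c0 n.+1 (leqnn _)).
  by rewrite subr_ge0 => /(_ (Ad _)); lra.
by apply: eq_big_nat => k /andP[_ kn]; rewrite subSn.
Qed.

(* Comparison with the sequence equal to [0] at [0] and to [g / A n]
   afterwards, whose discrete derivative is at least [g]. *)
Lemma conv_diff_comparison (A z : nat -> R) (g : R) (n : nat) :
  (forall j, 0 < A j) -> (forall j, A j.+1 <= A j) -> 0 <= g ->
  z 0%N <= 0 ->
  (forall m, (m <= n)%N ->
    \sum_(0 <= k < m.+1) A (m - k)%N * (z k.+1 - z k) <= g) ->
  z n.+1 <= g / A n.
Proof.
move=> A0 Ad g0 z0 zg.
pose c k := if k is 0%N then z 0%N else z k - g / A n.
have Amono m : (m <= n)%N -> A n <= A m.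
  exact: ((nonincreasing_seqP A).1 Ad).
suff : forall m, (m <= n.+1)%N -> c m <= 0.
  by move=> /(_ n.+1 (leqnn _)) /=; rewrite subr_le0.
elim/ltn_ind => -[//|m] IH mn.
have := @conv_diff_ge A c m (fun j => ltW (A0 j)) Ad _.
move=> /(_ (fun k km => IH k km (leq_trans km (ltnW mn)))) h.
rewrite -(pmulr_rle0 _ (A0 0%N)); apply: (le_trans h).
(* The comparison sequence jumps only from index 0 to index 1, so it changes only the term k = 0, of
   weight [A m]; since [A n <= A m], this jump contributes at least [g]. *)
have -> : \sum_(0 <= k < m.+1) A (m - k)%N * (c k.+1 - c k) =
   \sum_(0 <= k < m.+1) A (m - k)%N * (z k.+1 - z k) - A m * (g / A n).
  rewrite big_nat_recl// [in RHS]big_nat_recl//= subn0.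
  rewrite (eq_big_nat _ _ (F2 := fun k => A (m - k.+1)%N * (z k.+2 - z k.+1))).
    by ring.
  by move=> k _ /=; congr (_ * _); ring.
rewrite subr_le0 (le_trans (zg _ _))//.
by rewrite mulrA ler_pdivlMr// mulrC ler_wpM2r// Amono.
Qed.

(** The sequence [B * (1 + q) ^+ m] satisfies the recurrence with equality ([geo]), so strong
    induction keeps [w] below it. *)
Lemma discrete_gronwall (w : nat -> R) (B q : R) (n : nat) :
  0 <= B -> 0 <= q ->
  (forall m, (m <= n)%N -> w m <= B + q * \sum_(0 <= j < m) w j) ->
  w n <= B * (1 + q) ^+ n.
Proof.
move=> B0 q0 h.
have geo m : B + q * \sum_(0 <= j < m) (B * (1 + q) ^+ j) = B * (1 + q) ^+ m.
  elim: m => [|m IH]; first by rewrite big_geq// mulr0 addr0 expr0 mulr1.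
  by rewrite big_nat_recr//= mulrDr addrA IH exprS; ring.
have : forall m, (m <= n)%N -> w m <= B * (1 + q) ^+ m; last exact.
elim/ltn_ind => m IH mn; rewrite -geo (le_trans (h _ mn))// lerD2l.
rewrite ler_wpM2l// ler_sum_nat// => j /andP[_ jm].
by rewrite IH// (leq_trans (ltnW jm)).
Qed.

Lemma ler_sum_nat_subrange (F : nat -> R) (m n m' n' : nat) :
  (forall k, 0 <= F k) -> (m' <= m)%N -> (n <= n')%N ->
  \sum_(m <= k < n) F k <= \sum_(m' <= k < n') F k.
Proof.
move=> F0 mm nn; have [nm|mn] := leqP n m.
  by rewrite big_geq// sumr_ge0.
rewrite [leRHS](@big_cat_nat _ _ _ m)//=; last exact: leq_trans (ltnW mn) nn.
rewrite [X in _ + X](@big_cat_nat _ _ _ n)//=; last exact: ltnW.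
by rewrite ler_wpDl ?sumr_ge0// ler_wpDr ?sumr_ge0.
Qed.

(** The sum is split at [P]: the early terms are history, the late ones are [w 1], ..., [w (m - P)].
    As [P] is positive these indices stay below [m], which is what makes the later Gronwall
    inequality explicit. *)
Lemma sum_delayed_le (d phi w : nat -> R) (P m : nat) : (0 < P)%N ->
  (forall k, 0 <= phi k) -> (forall k, 0 <= w k) ->
  (forall k, (1 <= k <= P)%N -> d k = phi k) ->
  (forall k, d (k + P)%N = w k) ->
  \sum_(0 <= j < m) d j.+1 <=
  \sum_(1 <= k < P.+1) phi k + \sum_(0 <= j < m) w j.
Proof.
move=> P0 phi0 w0 dphi dw.
have dle (r : nat) : (r <= P)%N ->
    \sum_(0 <= j < r) d j.+1 <= \sum_(1 <= k < P.+1) phi k.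
  move=> rP; rewrite (eq_big_nat _ _ (F2 := fun j => phi j.+1)).
    by rewrite big_add1/= ler_sum_nat_subrange.
  by move=> j /andP[_ jr]; rewrite dphi//= (leq_trans jr).
have [mP|Pm] := leqP m P; first by rewrite ler_wpDr ?sumr_ge0// dle.
rewrite (@big_cat_nat _ _ _ P)//=; last exact: ltnW.
rewrite lerD ?dle// -{1}(add0n P) big_addn.
rewrite (eq_bigr (fun j => w j.+1)); last by move=> j _; rewrite -addSn dw.
rewrite -(big_add1 _ _ 0%N (m - P).+1 xpredT w) ler_sum_nat_subrange//.
by rewrite ltn_subrL P0 (leq_trans _ Pm).
Qed.

(** Discriminant argument: for positive [z] the quadratic is evaluated at its minimiser [y / z]. *)
Lemma cauchy_schwarz_of_quadratic_ge0 (x y z : R) : 0 <= x -> 0 <= z ->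
  (forall s, 0 <= x - 2 * s * y + s ^+ 2 * z) ->
  y <= Num.sqrt x * Num.sqrt z.
Proof.
move=> x0 z0 h.
rewrite -sqrtrM//; have [y0|y0] := leP y 0.
  by rewrite (le_trans y0)// sqrtr_ge0.
rewrite -[leLHS](ger0_norm (ltW y0)) -sqrtr_sqr.
rewrite ler_sqrt ?mulr_ge0//.
have [z_0|z_neq0] := eqVneq z 0.
  (* For [z = 0] the quadratic is affine in [s], and at this point it equals -1. *)
  have := h ((x + 1) / (2 * y)).
  rewrite z_0 mulr0 addr0.
  have -> : 2 * ((x + 1) / (2 * y)) * y = x + 1 by field; rewrite gt_eqF.
  by lra.
have zp : 0 < z by rewrite lt_neqAle eq_sym z_neq0.
have := h (y / z).
have -> : x - 2 * (y / z) * y + (y / z) ^+ 2 * z = (x * z - y ^+ 2) / z.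
  by field.
by rewrite pmulr_lge0 ?invr_gt0// subr_ge0.
Qed.

End DiscreteInequalities.

(** * Concavity of real powers *)

Section Powers.
Variable R : realType.
Implicit Types x y b : R.

(** This is Young's inequality with conjugate exponents [b^-1] and [(1 - b)^-1], applied to (y/x)^b
    and 1 and then scaled by x^b. *)
Lemma powR_tangent x y b : 0 < b -> b < 1 -> 0 < x -> 0 <= y ->
  y `^ b <= x `^ b + b * x `^ (b - 1) * (y - x).
Proof.
move=> b0 b1 x0 y0.
have x0' := ltW x0; have yx0 : 0 <= y / x by rewrite divr_ge0.
have b'0 : 0 < 1 - b by rewrite subr_gt0.
have := @conjugate_powR R ((y / x) `^ b) 1 b^-1 (1 - b)^-1 (powR_ge0 _ _)
  ler01.
rewrite !invr_gt0 !invrK => /(_ b0 b'0 (subrKC _ _)).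
rewrite mulr1 powR1 mul1r -powRrM divff ?gt_eqF//.
rewrite powRr1// => h.
have -> : y `^ b = x `^ b * (y / x) `^ b.
  by rewrite -powRM// mulrC divfK ?gt_eqF.
rewrite (le_trans (ler_wpM2l (powR_ge0 _ _) h))//.
rewrite powRB; last by rewrite (gt_eqF x0) implybT.
rewrite powRr1//.
rewrite [leRHS](_ : _ = x `^ b * (y / x * b + (1 - b)))//.
by field; rewrite gt_eqF.
Qed.

End Powers.

(** * Sign, monotonicity and lower bound of the L1 weights *)

Section L1Coefficients.
Variables (R : realType) (alpha tau : R) (N : nat).
Hypotheses (alpha_gt0 : 0 < alpha) (alpha_lt1 : alpha < 1).
Hypotheses (tau_gt0 : 0 < tau) (N_gt0 : (0 < N)%N).
Hypothesis Gamma_gt0 : 0 < Gamma (2 - alpha).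
Local Notation rho := (step tau N).
(** Fixing k = 1 and n = j + 1 indexes the weight by its lag alone: this is a_j. *)
Local Notation A := (fun j : nat => l1coef alpha tau N j.+1 1).

Lemma step_gt0 : 0 < rho.
Proof. by rewrite /step divr_gt0// ltr0n muln_gt0. Qed.

Lemma l1coefE (j : nat) : A j =
  ((j.+1%:R * rho) `^ (1 - alpha) - (j%:R * rho) `^ (1 - alpha))
  / (Gamma (2 - alpha) * rho).
Proof.
rewrite /l1coef /omega /time.
have -> : 2 - alpha - 1 = 1 - alpha by ring.
have -> : j.+1%:Z%:~R * rho - (1%:Z - 1)%:~R * rho = j.+1%:R * rho.
  by rewrite subrr mul0r subr0.
have -> : j.+1%:Z%:~R * rho - 1%:Z%:~R * rho = j%:R * rho.
  by rewrite -mulrBl -[j.+1%:Z%:~R]/j.+1%:R -natr1 addrK.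
by rewrite -mulrBl -mulrA -invfM.
Qed.

Lemma l1coef_shift (n k : nat) : (k < n)%N ->
  l1coef alpha tau N n k.+1 = A (n.-1 - k)%N.
Proof.
move=> kn; rewrite /l1coef; congr ((omega _ _ - omega _ _) / _).
- rewrite /time -!mulrBl -!intrB; congr (_%:~R * _); lia.
- rewrite /time -!mulrBl -!intrB; congr (_%:~R * _); lia.
Qed.

(** The bound is the derivative of omega_{2-alpha} at t_{j+1}, its smallest slope on [t_j, t_{j+1}]
    by concavity: the tangent at t_{j+1} is evaluated at t_j. *)
Lemma l1coef_ge (j : nat) :
  (1 - alpha) / Gamma (2 - alpha) / (j.+1%:R * rho) `^ alpha <= A j.
Proof.
have rho0 := step_gt0.
rewrite l1coefE.
have jrho : 0 < j.+1%:R * rho by rewrite mulr_gt0.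
have := @powR_tangent R _ (j%:R * rho) (1 - alpha) _ _ jrho _.
rewrite subr_gt0 gtrBl => /(_ alpha_lt1 alpha_gt0).
rewrite (mulr_ge0 _ (ltW rho0))// => /(_ isT).
rewrite -mulrBl -natr1 opprD addNKr mulN1r.
have -> : 1 - alpha - 1 = - alpha by ring.
rewrite powRN natr1 => h.
rewrite ler_pdivlMr ?(mulr_gt0 Gamma_gt0 rho0)//.
have -> : (1 - alpha) / Gamma (2 - alpha) / (j.+1%:R * rho) `^ alpha
  * (Gamma (2 - alpha) * rho) = (1 - alpha) / (j.+1%:R * rho) `^ alpha * rho.
  by field; rewrite !gt_eqF// powR_gt0.
by lra.
Qed.

Lemma l1coef_gt0 (j : nat) : 0 < A j.
Proof.
apply: lt_le_trans (l1coef_ge j).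
rewrite !divr_gt0 ?subr_gt0// powR_gt0// mulr_gt0//.
exact: step_gt0.
Qed.

(** The tangent at t_{j+1} lies above the power at both t_j and t_{j+2}; adding the two inequalities
    cancels the slope terms. *)
Lemma l1coef_decr (j : nat) : A j.+1 <= A j.
Proof.
have rho0 := step_gt0.
rewrite !l1coefE ler_wpM2r//.
  by rewrite invr_ge0 ltW// (mulr_gt0 Gamma_gt0 rho0).
have jrho : 0 < j.+1%:R * rho by rewrite mulr_gt0.
have tg y := @powR_tangent R _ y (1 - alpha) _ _ jrho.
rewrite subr_gt0 gtrBl in tg; have {}tg := tg alpha_lt1 alpha_gt0.
have := tg _ (mulr_ge0 (ler0n _ j) (ltW rho0)).
have := tg _ (mulr_ge0 (ler0n _ j.+2) (ltW rho0)).
have e1 : j.+2%:R * rho - j.+1%:R * rho = rho.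
  by rewrite -mulrBl -[j.+2%:R]natr1 addrC addKr mul1r.
have e2 : j%:R * rho - j.+1%:R * rho = - rho.
  by rewrite -mulrBl -natr1 opprD addNKr mulN1r.
by rewrite e1 e2; lra.
Qed.

End L1Coefficients.

(** * Positivity of the Gamma function on ]1, 2[ *)

Section GammaPositivity.
Variable R : realType.
Local Notation mu := (@lebesgue_measure R).

Let integrand (beta : R) := fun s : R => s `^ (beta - 1) * expR (- s).

Let measurable_integrand beta (D : set R) :
  measurable_fun D (integrand beta).
Proof.
apply: measurable_funS (_ : measurable_fun setT _) => //.
apply: measurable_funM; first exact: measurable_powR.
by apply: measurableT_comp => //; exact: measurable_expR.
Qed.

(** The dominating function is 2 e^{-s/2}, written through the exponential density of rate 1/2;
    s^{beta-1} <= 1 + s <= 2 e^{s/2} costs half of the decay. *)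
Let integrable_integrand beta : 1 < beta -> beta < 2 ->
  mu.-integrable `]0, +oo[ (EFin \o integrand beta).
Proof.
move=> b1 b2.
have i2 : mu.-integrable `]0, +oo[
    (EFin \o (fun s => 4 * exponential_pdf 2^-1 s)).
  apply: (@integrableS _ _ _ mu setT) => //.
  have := @integrableZl _ _ _ mu setT measurableT 4
    _ (@integrable_exponential_pdf R 2^-1 _).
  rewrite invr_gt0 ltr0n => /(_ isT).
  by under eq_fun do rewrite /= -EFinM.
apply: le_integrable i2 => //.
  by apply: measurableT_comp => //; exact: measurable_integrand.
move=> s /=; rewrite in_itv/= andbT => s0.
rewrite lee_fin /integrand !ger0_norm; last 2 first.
- by rewrite mulr_ge0// exponential_pdf_ge0.
- by rewrite mulr_ge0// ?powR_ge0// expR_ge0.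
rewrite exponential_pdfE/=; last exact: ltW.
have -> : expR (- s) = (expR (2^-1 * s))^-1 * expR (- 2^-1 * s).
  by rewrite -expRN -expRD; congr expR; field.
rewrite !mulrA ler_wpM2r ?expR_ge0// ler_pdivrMr ?expR_gt0//.
have e : 1 + 2^-1 * s <= expR (2^-1 * s) by exact: expR_ge1Dx.
have : s `^ (beta - 1) <= 1 + s.
  have [s1|s1] := leP s 1.
    rewrite (le_trans (_ : _ <= 1))//; last by rewrite lerDl ltW.
    rewrite [leRHS](_ : 1 = 1 `^ (beta - 1)); last by rewrite powR1.
    by rewrite ge0_ler_powR ?nnegrE//; lra.
  rewrite (le_trans (_ : _ <= s))//; last by rewrite lerDr.
  by rewrite ler1_powR//; lra.
by lra.
Qed.

(** On [1, 2] the integrand is at least e^{-2}. The range of [beta] covers [2 - alpha] and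
    [1 + alpha]. *)
Lemma Gamma_gt0 (beta : R) : 1 < beta -> beta < 2 -> 0 < Gamma beta.
Proof.
move=> b1 b2.
have := integrable_integrand beta b1 b2 => ib.
have s12 : (`[1, 2] : set R) `<=` `]0, +oo[.
  by move=> s /=; rewrite !in_itv/= andbT => /andP[s1 _]; exact: lt_le_trans s1.
have i12 : mu.-integrable `[1, 2] (EFin \o integrand beta).
  exact: integrableS ib.
apply: (@lt_le_trans _ _ (\int[mu]_(s in `[1, 2]) integrand beta s)).
  apply: (@lt_le_trans _ _ (\int[mu]_(s in `[1%R, 2%R]) (expR (- 2)))).
    rewrite Rintegral_cst//= lebesgue_measure_itv/= lte_fin ifT; last by lra.
    by rewrite -EFinB/= mulr_gt0 ?expR_gt0//; lra.
  apply: le_Rintegral => //.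
    apply: continuous_compact_integrable; first exact: segment_compact.
    by move=> ?; exact: cvg_cst.
  move=> s /=; rewrite in_itv/= => /andP[s1 s2].
  rewrite -[leLHS]mul1r ler_pM ?expR_ge0// ?ler_expR ?lerN2//.
  rewrite [leLHS](_ : 1 = s `^ 0); last by rewrite powRr0.
  by rewrite ler_powR//; lra.
(* [fine] sends infinity to 0, so both integrals must be known to be finite before they are
   compared. *)
rewrite /Gamma /Rintegral fine_le//.
- exact: integrable_fin_num.
- exact: integrable_fin_num.
apply: ge0_subset_integral => //.
- by apply: measurableT_comp => //; exact: measurable_integrand.
- by move=> s _; rewrite lee_fin mulr_ge0 ?powR_ge0 ?expR_ge0.
Qed.

End GammaPositivity.

(** * The L2 inner product on bounded measurable functions *)

Section InnerProduct.
Variables (R : realType) (L : R).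
Hypothesis L_gt0 : 0 < L.
Local Notation mu := (@lebesgue_measure R).
Implicit Types v w : R -> R.

(* On this class the integrals defining [inner] are finite, so that [inner] is
   bilinear; it contains the finite element space and the source terms. *)
Definition bounded_measurable v : Prop :=
  measurable_fun `]0, L[ v /\
  exists M : R, forall y, y \in `]0, L[ -> `|v y| <= M.

Lemma bounded_measurable_continuous v :
  {within `[0, L], continuous v} -> bounded_measurable v.
Proof.
move=> cv; split.
  apply: subspace_continuous_measurable_fun => //.
  exact: continuous_subspaceW (@subset_itv_oo_cc _ _ _ _) cv.
have /compact_bounded[M [_ Mv]] := continuous_compact cv
  (@segment_compact _ _ _).
exists (`|M| + 1) => y /subset_itv_oo_cc y0L.
apply: (Mv (`|M| + 1)); last by exists y.
by rewrite (le_lt_trans (ler_norm _))// ltrDl.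
Qed.

Lemma bounded_measurable_integrable v : bounded_measurable v ->
  mu.-integrable `]0, L[ (EFin \o v).
Proof.
move=> [mv [M vM]]; apply: measurable_bounded_integrable => //.
  by rewrite /= lebesgue_measure_itv/=; case: ifPn; rewrite ?ltry// -EFinB ltry.
exists M; split; first exact: num_real.
by move=> r Mr y /= /vM /le_trans; apply; exact: ltW.
Qed.

Lemma bounded_measurable_cst r : bounded_measurable (fun=> r).
Proof. by split; [exact: measurable_cst | exists `|r|]. Qed.

Lemma bounded_measurableD v w : bounded_measurable v -> bounded_measurable w ->
  bounded_measurable (fun y => v y + w y).
Proof.
move=> [mv [M vM]] [mw [M' wM']]; split; first exact: measurable_funD.
exists (M + M') => y y0L.
by rewrite (le_trans (ler_normD _ _))// lerD ?vM ?wM'.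
Qed.

Lemma bounded_measurableM v w : bounded_measurable v -> bounded_measurable w ->
  bounded_measurable (fun y => v y * w y).
Proof.
move=> [mv [M vM]] [mw [M' wM']]; split; first exact: measurable_funM.
by exists (M * M') => y y0L; rewrite normrM ler_pM ?vM ?wM'.
Qed.

Lemma bounded_measurableZ r v : bounded_measurable v ->
  bounded_measurable (fun y => r * v y).
Proof. exact: bounded_measurableM (bounded_measurable_cst r). Qed.

Lemma bounded_measurableB v w : bounded_measurable v -> bounded_measurable w ->
  bounded_measurable (fun y => v y - w y).
Proof.
move=> bv bw; rewrite (_ : (fun y => v y - w y) = fun y => v y + -1 * w y).
  exact/bounded_measurableD/bounded_measurableZ.
by apply/funext => y; rewrite mulN1r.
Qed.

Lemma bounded_measurable_sum (s : seq nat) (P : pred nat) (F : nat -> R -> R) :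
  (forall k, P k -> bounded_measurable (F k)) ->
  bounded_measurable (fun y => \sum_(k <- s | P k) F k y).
Proof.
move=> bF; elim: s => [|k s IH].
  rewrite (_ : (fun y => _) = fun=> 0); first exact: bounded_measurable_cst.
  by apply/funext => y; rewrite big_nil.
have [Pk|Pk] := boolP (P k); last first.
  rewrite (_ : (fun y => _) = fun y => \sum_(j <- s | P j) F j y)//.
  by apply/funext => y; rewrite big_cons (negbTE Pk).
rewrite (_ : (fun y => _) = fun y => F k y + \sum_(j <- s | P j) F j y).
  by apply: bounded_measurableD => //; exact: bF.
by apply/funext => y; rewrite big_cons Pk.
Qed.

Lemma inner_ge0 v : 0 <= inner L v v.
Proof. by apply: Rintegral_ge0 => y _; rewrite -expr2 sqr_ge0. Qed.

Lemma innerC v w : inner L v w = inner L w v.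
Proof. by apply: eq_Rintegral => y _; rewrite mulrC. Qed.

Lemma eq_inner v v' w w' : {in `]0, L[, v =1 v'} -> {in `]0, L[, w =1 w'} ->
  inner L v w = inner L v' w'.
Proof.
by move=> vv' ww'; apply: eq_Rintegral => y; rewrite inE/= => y0L;
  rewrite vv' ?ww'.
Qed.

Lemma innerDl v v' w : bounded_measurable v -> bounded_measurable v' ->
  bounded_measurable w ->
  inner L (fun y => v y + v' y) w = inner L v w + inner L v' w.
Proof.
move=> bv bv' bw; rewrite /inner -RintegralD//;
  try exact/bounded_measurable_integrable/bounded_measurableM.
by apply: eq_Rintegral => y _; rewrite mulrDl.
Qed.

Lemma innerZl r v w : bounded_measurable v -> bounded_measurable w ->
  inner L (fun y => r * v y) w = r * inner L v w.
Proof.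
move=> bv bw; rewrite /inner -RintegralZl//;
  try exact/bounded_measurable_integrable/bounded_measurableM.
by apply: eq_Rintegral => y _; rewrite mulrA.
Qed.

Lemma innerBl v v' w : bounded_measurable v -> bounded_measurable v' ->
  bounded_measurable w ->
  inner L (fun y => v y - v' y) w = inner L v w - inner L v' w.
Proof.
move=> bv bv' bw.
rewrite (_ : (fun y => v y - v' y) = fun y => v y + -1 * v' y); last first.
  by apply/funext => y; rewrite mulN1r.
rewrite innerDl ?innerZl ?mulN1r//.
exact: bounded_measurableZ.
Qed.

Lemma inner_suml (s : seq nat) (P : pred nat) (F : nat -> R -> R) w :
  (forall k, P k -> bounded_measurable (F k)) -> bounded_measurable w ->
  inner L (fun y => \sum_(k <- s | P k) F k y) w =
  \sum_(k <- s | P k) inner L (F k) w.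
Proof.
move=> bF bw; elim: s => [|k s IH].
  rewrite big_nil /inner (@eq_Rintegral _ _ _ _ _ (fun=> 0)); last first.
    by move=> y _; rewrite big_nil mul0r.
  by rewrite Rintegral_cst// mul0r.
have [Pk|Pk] := boolP (P k); last first.
  rewrite big_cons (negbTE Pk) -IH; congr (inner _ _ _).
  by apply/funext => y; rewrite big_cons (negbTE Pk).
rewrite big_cons Pk -IH -innerDl//; last exact: bounded_measurable_sum.
  by congr (inner _ _ _); apply/funext => y; rewrite big_cons Pk.
exact: bF.
Qed.

(** The nonnegative quadratic in [s] is the expanded squared norm of v - s w. *)
Lemma inner_cauchy_schwarz v w :
  bounded_measurable v -> bounded_measurable w ->
  inner L v w <= l2norm L v * l2norm L w.
Proof.
move=> bv bw.
apply: cauchy_schwarz_of_quadratic_ge0; rewrite ?inner_ge0// => s.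
have := inner_ge0 (fun y => v y - s * w y).
have bsw := bounded_measurableZ s _ bw.
have bd := bounded_measurableB _ _ bv bsw.
rewrite innerBl// innerZl// (innerC v) (innerC w) !innerBl// !innerZl//.
by rewrite (innerC w v); congr (0 <= _); ring.
Qed.

Lemma norm_inner_le v w : bounded_measurable v -> bounded_measurable w ->
  `|inner L v w| <= l2norm L v * l2norm L w.
Proof.
move=> bv bw; rewrite ler_norml inner_cauchy_schwarz// andbT lerNl -mulN1r.
rewrite -innerZl//.
rewrite (_ : l2norm L v = l2norm L (fun y => -1 * v y)).
  exact/inner_cauchy_schwarz/bw/bounded_measurableZ.
rewrite /l2norm; congr (Num.sqrt _); apply: eq_Rintegral => y _.
by rewrite !mulN1r mulrNN.
Qed.

Lemma bounded_measurable_sum_nat (m n : nat) (F : nat -> R -> R) :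
  (forall k, (m <= k < n)%N -> bounded_measurable (F k)) ->
  bounded_measurable (fun y => \sum_(m <= k < n) F k y).
Proof.
(* The index range is repeated as a filter, so that it can serve as the predicate of
   [bounded_measurable_sum]. *)
move=> bF; rewrite (_ : (fun y => _) =
  fun y => \sum_(m <= k < n | (m <= k < n)%N) F k y).
  exact: bounded_measurable_sum.
by apply/funext => y; rewrite big_nat.
Qed.

Lemma inner_sum_nat (m n : nat) (F : nat -> R -> R) w :
  (forall k, (m <= k < n)%N -> bounded_measurable (F k)) ->
  bounded_measurable w ->
  inner L (fun y => \sum_(m <= k < n) F k y) w =
  \sum_(m <= k < n) inner L (F k) w.
Proof.
move=> bF bw; rewrite [RHS]big_nat -inner_suml//; congr (inner _ _ _).
by apply/funext => y; rewrite big_nat.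
Qed.

Lemma l2norm_ge0 v : 0 <= l2norm L v. Proof. exact: sqrtr_ge0. Qed.

Lemma inner_self v : inner L v v = l2norm L v * l2norm L v.
Proof. by rewrite -expr2 sqr_sqrtr// inner_ge0. Qed.

End InnerProduct.
Arguments bounded_measurable {R} L v.

(** * Boundedness and measurability of the source term *)

Section SourceTerm.
Variable R : realType.
Local Notation mu := (@lebesgue_measure R).

Lemma is_derive_powR_reflect (t a s : R) : s < t ->
  is_derive s 1 (fun x : R => (t - x) `^ a) (- (a * (t - s) `^ (a - 1))).
Proof.
move=> st.
have ts0 : 0 < t - s by rewrite subr_gt0.
have h := is_derive1_powR a ts0.
have -> : (fun x : R => (t - x) `^ a) =
  (@powR R ^~ a) \o (fun x => t - x) by [].
apply: is_derive_eq.
by rewrite add0r mul1r mulrN1.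
Qed.

(** For b < 1 the kernel is singular at s = t. On intervals exhausting [0, t[ the antiderivative -(t
    - s)^b / b bounds the integral by t^b / b, and monotone convergence passes to the limit. *)
Lemma integrable_powR_reflect (b t : R) : 0 < b -> 0 < t ->
  mu.-integrable `]0, t[ (EFin \o (fun s => (t - s) `^ (b - 1))).
Proof.
move=> b0 t0; pose k (s : R) := (t - s) `^ (b - 1).
have mk (D : set R) : measurable_fun D (EFin \o k).
  apply: (@measurable_funS _ _ _ _ setT) => //.
  apply: measurableT_comp => //.
  apply: (@measurableT_comp _ _ _ _ _ _ (@powR R ^~ (b - 1))).
    exact: measurable_powR.
  exact: measurable_funB.
(* The shift by 2 makes the right endpoint positive already for n = 0, so that the fundamental
   theorem of calculus applies to every [F n]. *)
pose F (n : nat) : set R := `[0, t - t / n.+2%:R]%classic.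
have Ft n x : F n x -> x < t.
  rewrite /F /= in_itv/= => /andP[_ /le_lt_trans]; apply.
  by rewrite gtrBl divr_gt0.
have Fk n : (\int[mu]_(s in F n) (k s)%:E <= (t `^ b / b)%:E)%E.
  have c0 : 0 < t - t / n.+2%:R.
    by rewrite subr_gt0 ltr_pdivrMr// ltr_pMr// ltr1n.
  pose P (s : R) := - b^-1 * (t - s) `^ b.
  have dP s : s < t -> is_derive s 1 P (k s).
    move=> st; have h := is_derive_powR_reflect t b s st.
    apply: is_derive_eq.
    by rewrite /GRing.scale/= mulrNN mulKf// gt_eqF.
  have cP s : s < t -> {for s, continuous P}.
    move=> st; apply/differentiable_continuous/derivable1_diffP.
    exact: (@ex_derive _ _ _ _ _ _ _ (dP s st)).
  rewrite (@continuous_FTC2 R k P 0 (t - t / n.+2%:R))//.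
  - rewrite -EFinB lee_fin /P subr0 -mulrBr mulNr -mulrN opprB mulrC.
    by rewrite ler_wpM2r ?invr_ge0 ?gerBl ?powR_ge0// ltW.
  - apply: continuous_in_subspaceT => s /set_mem /Ft st.
    apply/differentiable_continuous/derivable1_diffP.
    by have [] := is_derive_powR_reflect t (b - 1) s st.
  - split.
    + by move=> s /subset_itv_oo_cc /Ft st; have [] := dP s st.
    + by apply/cvg_at_right_filter/cP.
    + apply/cvg_at_left_filter/cP; apply: (Ft n).
      by rewrite /F /= in_itv/= ltW/=.
  - move=> s /subset_itv_oo_cc /Ft st.
    by rewrite derive1E; have [] := dP s st.
apply/integrableP; split; first exact: mk.
under eq_integral do rewrite /= ger0_norm ?powR_ge0//.
apply: (@le_lt_trans _ _ (\int[mu]_(s in \bigcup_n F n) (k s)%:E)%E).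
  apply: ge0_subset_integral => //.
  - by apply: bigcup_measurable => n _; exact: measurable_itv.
  - exact: mk.
  - by move=> s _; rewrite lee_fin powR_ge0.
  - move=> s /=; rewrite in_itv/= => /andP[s0 st].
    have [n nst] : exists n : nat, t / (t - s) < n%:R.
      exists (Num.truncn (t / (t - s))).+1; exact: truncnS_gt.
    exists n => //; rewrite /F /= in_itv/= (ltW s0)/= lerBrDr addrC -lerBrDr.
    have ts0 : 0 < t - s by rewrite subr_gt0.
    rewrite ler_pdivrMr// mulrC -ler_pdivrMr//.
    by rewrite (le_trans (ltW nst))// ler_nat; lia.
apply: (@le_lt_trans _ _ (t `^ b / b)%:E); last exact: ltry.
have mono : nondecreasing_seq F.
  apply/nondecreasing_seqP => n; apply/subsetPset => x; rewrite /F /= !in_itv/=.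
  move=> /andP[-> /=] /le_trans; apply.
  rewrite lerD2l lerN2 ler_pM2l// lef_pV2 ?posrE// ler_nat; lia.
have := @ge0_nondecreasing_set_cvg_integral _ (measurableTypeR R) R F
  (EFin \o k) mu mono (fun=> measurable_itv _) (fun n => mk (F n)).
move=> /(_ (fun n x _ => powR_ge0 _ _)) /cvge_to_le; apply.
exact: nearW.
Qed.

(** At an interior point the relative neighbourhoods of the rectangle are those of the plane. *)
Lemma continuous_rectangle_interior (f : R * R -> R) (L T y s : R) :
  {within `[0, L] `*` `[0, T], continuous f} -> 0 < y < L -> 0 < s < T ->
  {for (y, s), continuous f}.
Proof.
move=> cf yL sT; have := cf (y, s).
rewrite /prop_for /continuous_at -nbhs_subspace_interior//.
exists (`[0, L]%classic, `[0, T]%classic) => /=; last by [].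
split.
- have : y \in `]0, L[ by rewrite in_itv.
  by move/near_in_itvoo; apply: filterS => z /subset_itv_oo_cc.
- have : s \in `]0, T[ by rewrite in_itv.
  by move/near_in_itvoo; apply: filterS => z /subset_itv_oo_cc.
Qed.

(** Measurability in space follows from continuity under the integral sign: with [M] bounding |f| on
    the compact rectangle, M |omega_{1-alpha}(t - s)| is an integrable dominating function for all
    [y] at once, and its integral also bounds the source. *)
Lemma bounded_measurable_source (L alpha T t : R) (f : R -> R -> R) :
  0 < alpha -> alpha < 1 -> 0 < t -> t <= T ->
  {within `[0, L] `*` `[0, T], continuous (fun z : R * R => f z.1 z.2)} ->
  bounded_measurable L (source alpha f t).
Proof.
move=> alpha0 alpha1 t0 tT cf.
have [M fM] : exists M : R, forall y s, y \in `[0, L] -> s \in `[0, T] ->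
    `|f y s| <= M.
  have /compact_bounded[M [_ Mf]] := continuous_compact cf
    (compact_setX (@segment_compact _ 0 L) (@segment_compact _ 0 T)).
  exists (`|M| + 1) => y s yL sT.
  apply: (Mf (`|M| + 1)); last by exists (y, s).
  by rewrite (le_lt_trans (ler_norm _))// ltrDl.
pose k s := omega (1 - alpha) (t - s).
have ik : mu.-integrable `]0, t[ (EFin \o k).
  rewrite (_ : k = fun s =>
    (Gamma (1 - alpha))^-1 * (t - s) `^ (1 - alpha - 1)); last first.
    by apply/funext => s; rewrite /k /omega mulrC.
  have := @integrable_powR_reflect (1 - alpha) t _ t0.
  rewrite subr_gt0 => /(_ alpha1).
  move/(@integrableZl _ _ _ mu _ _ (Gamma (1 - alpha))^-1) => /(_ _).
  exact.
have ig : mu.-integrable `]0, t[ (EFin \o (fun s => M * `|k s|)).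
  have /integrable_abse := ik.
  move/(@integrableZl _ _ _ mu _ _ M) => /(_ _).
  exact.
have cfy y s : 0 < y < L -> 0 < s < t -> {for s, continuous (f y)}.
  move=> yL /andP[s0 st].
  apply: (@continuous_comp R (R * R)%type R (fun s : R => (y, s))
    (fun z : R * R => f z.1 z.2)).
    by apply: (@cvg_pair _ _ _ (nbhs s) (nbhs y) (nbhs s));
      [exact: cvg_cst|exact: cvg_id].
  apply: continuous_rectangle_interior cf yL _.
  by rewrite s0 (lt_le_trans st).
have cfs y s : 0 < y < L -> 0 < s < t -> {for y, continuous (f ^~ s)}.
  move=> yL /andP[s0 st].
  apply: (@continuous_comp R (R * R)%type R (fun y : R => (y, s))
    (fun z : R * R => f z.1 z.2)).
    by apply: (@cvg_pair _ _ _ (nbhs y) (nbhs y) (nbhs s));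
      [exact: cvg_id|exact: cvg_cst].
  apply: continuous_rectangle_interior cf yL _.
  by rewrite s0 (lt_le_trans st).
have dom y s : y \in `]0, L[ -> s \in `]0, t[ -> `|k s * f y s| <= M * `|k s|.
  move=> yL; rewrite in_itv/= => /andP[s0 st].
  rewrite normrM mulrC ler_wpM2r// fM//; first exact: subset_itv_oo_cc.
  by rewrite in_itv/= (ltW s0) (le_trans (ltW st)).
have ikf y : y \in `]0, L[ ->
    mu.-integrable `]0, t[ (EFin \o (fun s => k s * f y s)).
  move=> yL; apply: le_integrable ig => //.
    apply: measurableT_comp => //; apply: measurable_funM.
      by move/integrableP: ik => [/measurable_EFinP].
    apply: subspace_continuous_measurable_fun => //.
    apply: continuous_in_subspaceT => s; rewrite inE/= in_itv/= => st.
    by apply: cfy => //; move: yL; rewrite in_itv.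
  move=> s /= st; rewrite lee_fin [leRHS]ger0_norm ?dom//.
  by rewrite (le_trans _ (dom y s yL st)).
split.
  apply: subspace_continuous_measurable_fun => //.
  apply: continuous_in_subspaceT.
  apply: (@continuity_under_integral R _ _ mu (fun y s => k s * f y s)
    `]0, t[ _ 0 L _ _ (fun s => M * `|k s|) ig) => //.
  - apply: aeW => s /= st y; rewrite inE/= => yL.
    apply: cvgM; first exact: cvg_cst.
    by apply: cfs; [move: yL|move: st]; rewrite in_itv.
  - by move=> y yL; apply: aeW => s /= st; exact: dom.
exists (\int[mu]_(s in `]0, t[) (M * `|k s|)) => y yL.
rewrite (le_trans (le_normr_Rintegral _ (ikf y yL)))//.
apply: le_Rintegral => //.
  exact: integrable_norm (ikf y yL).
by move=> s /= st; exact: dom.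
Qed.

End SourceTerm.

(** * Stability of the discrete solution *)

Section Scheme.
Variables (R : realType) (L alpha tau p a b : R) (K N M : nat) (x : nat -> R).
Variables (f : R -> R -> R) (phi u : int -> R -> R).
Hypotheses (L_gt0 : 0 < L) (alpha_gt0 : 0 < alpha) (alpha_lt1 : alpha < 1).
Hypotheses (tau_gt0 : 0 < tau) (p_gt0 : 0 < p) (a_le0 : a <= 0).
Hypotheses (N_gt0 : (0 < N)%N) (Gamma_gt0 : 0 < Gamma (2 - alpha)).
Hypothesis cf : {within `[0, L] `*` `[0, K%:R * tau],
  continuous (fun z : R * R => f z.1 z.2)}.
Hypothesis fe_phi : forall n : nat, (1 <= n <= 2 * N)%N ->
  fe_space L M x (phi (n%:Z - (2 * N)%:Z)).
Hypothesis sol : fem_solution L alpha tau p a b K N M x f phi u.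

Local Notation rho := (step tau N).
Local Notation A := (fun j : nat => l1coef alpha tau N j.+1 1).
Let W (k : nat) := l2norm L (u k%:Z).
Let D (k : nat) := l2norm L (u (k%:Z - (2 * N)%:Z)).
Let g (j : nat) := l2norm L (source alpha f (time tau N j%:Z)).

Lemma l2norm_delayed_phi k : (1 <= k <= 2 * N)%N ->
  D k = l2norm L (phi (k%:Z - (2 * N)%:Z)).
Proof.
move=> kN; rewrite /D /l2norm; congr (Num.sqrt _).
have [up _ _] := sol.
by apply: eq_inner => y yL; rewrite up//; exact: subset_itv_oo_cc.
Qed.

Lemma bounded_measurable_delayed k : (1 <= k <= 2 * K * N)%N ->
  bounded_measurable L (u (k%:Z - (2 * N)%:Z)).
Proof.
have [up ufe _] := sol.
move=> /andP[k1 kKN]; apply: bounded_measurable_continuous => //.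
have [kN|Nk] := leqP k (2 * N).
  have k12 : (1 <= k <= 2 * N)%N by rewrite k1.
  have [cphi _ _ _] := fe_phi k k12.
  apply: subspace_eq_continuous cphi => y; rewrite inE => yL.
  exact/esym/up.
rewrite subzn 1?ltnW//.
have := ufe (k - 2 * N)%N; rewrite subn_gt0 Nk (leq_trans (leq_subr _ _))//.
by move=> /(_ isT)[].
Qed.

Lemma bounded_measurable_sol k : (0 < K)%N -> (k <= 2 * K * N)%N ->
  bounded_measurable L (u k%:Z).
Proof.
move=> K0 kKN; have [-> {k kKN}|k0] := posnP k.
  (* The initial value is part of the history: it is the delayed term of index 2N, and [K >= 1]
     gives 2N <= 2KN. *)
  have := bounded_measurable_delayed (2 * N); rewrite subrr; apply.
  by rewrite muln_gt0 N_gt0/= leq_mul2r leq_pmulr ?orbT.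
have [_ ufe _] := sol.
have := ufe k; rewrite k0 kKN => /(_ isT)[cu _ _ _].
exact: bounded_measurable_continuous.
Qed.

Lemma time_le k : (k <= 2 * K * N)%N -> time tau N k%:Z <= K%:R * tau.
Proof.
move=> kKN; have rho0 := step_gt0 R tau N tau_gt0 N_gt0.
apply: (@le_trans _ _ ((2 * K * N)%:R * rho)).
  by rewrite /time ler_wpM2r ?(ltW rho0)// ler_nat.
rewrite /step le_eqVlt; apply/orP; left; apply/eqP.
by rewrite mulnAC mulnC !natrM; field; rewrite !pnatr_eq0 -!lt0n N_gt0.
Qed.

Lemma bounded_measurable_source_sol k : (1 <= k <= 2 * K * N)%N ->
  bounded_measurable L (source alpha f (time tau N k%:Z)).
Proof.
move=> /andP[k0 kKN]; have rho0 := step_gt0 R tau N tau_gt0 N_gt0.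
apply: bounded_measurable_source cf => //; last exact: time_le.
by rewrite /time mulr_gt0// ltr0n.
Qed.

Lemma DalphaE m : Dalpha alpha tau N u m = fun y =>
  \sum_(0 <= k < m) A (m.-1 - k)%N * (u k.+1%:Z y - u k%:Z y).
Proof.
apply/funext => y; rewrite /Dalpha big_add1/=.
apply: eq_big_nat => k /andP[_ km]; rewrite l1coef_shift// /nabla.
by have -> : k.+1%:Z - 1 = k%:Z by lia.
Qed.

Lemma JdelayE m : Jdelay alpha tau N u m = fun y =>
  \sum_(0 <= k < m) rho * A (m.-1 - k)%N * u (k.+1%:Z - (2 * N)%:Z) y.
Proof.
apply/funext => y; rewrite /Jdelay big_add1/=.
by apply: eq_big_nat => k /andP[_ km]; rewrite l1coef_shift.
Qed.

Lemma bilin_ge0 v : bounded_measurable L v -> 0 <= bilin L p a v v.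
Proof.
move=> bv; rewrite /bilin innerZl// subr_ge0.
by rewrite (@le_trans _ _ 0) ?mulr_le0_ge0 ?mulr_ge0 ?inner_ge0// ltW.
Qed.

(** The delayed term fits under the same sum because the discrete integral has the weights of the
    discrete derivative, times [rho]. *)
Lemma l2norm_scheme_le m : (0 < K)%N -> (m < 2 * K * N)%N ->
  \sum_(0 <= k < m.+1) A (m - k)%N *
    (W k.+1 - W k - rho * `|b| * D k.+1) <= g m.+1.
Proof.
move=> K0 mKN.
have A_gt0 j : 0 < A j by exact: l1coef_gt0.
have A_decr j : A j.+1 <= A j by exact: l1coef_decr.
have rho0 := step_gt0 R tau N tau_gt0 N_gt0.
have um := bounded_measurable_sol m.+1 K0 mKN.
have bu k : (k < m.+1)%N -> bounded_measurable L (u k%:Z).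
  by move=> km; apply: bounded_measurable_sol => //;
    exact: leq_trans (ltnW km) mKN.
have buS k : (k < m.+1)%N -> bounded_measurable L (u k.+1%:Z).
  by move=> km; apply: bounded_measurable_sol => //; exact: leq_trans km mKN.
have bd k : (k < m.+1)%N -> bounded_measurable L (u (k.+1%:Z - (2 * N)%:Z)).
  by move=> km; apply: bounded_measurable_delayed; exact: leq_trans km mKN.
rewrite (eq_bigr (fun k => A (m - k)%N * (W k.+1 - W k) -
  A (m - k)%N * (rho * `|b| * D k.+1))); last by move=> k _; rewrite mulrBr.
rewrite sumrB.
have D0 : 0 <= \sum_(0 <= k < m.+1) A (m - k)%N * (rho * `|b| * D k.+1).
  apply: sumr_ge0 => k _; rewrite mulr_ge0// ?(ltW (A_gt0 _))//.
  by rewrite !mulr_ge0// ?l2norm_ge0// ltW.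
(* The norm of the test function is to be divided out. If it vanishes, Abel summation applied to
   [- W] shows directly that the discrete derivative of [W] is at most 0. *)
have [Wm0|Wm_neq0] := eqVneq (W m.+1) 0.
  rewrite lerBlDr (@le_trans _ _ 0)//; last first.
    by rewrite addr_ge0// l2norm_ge0.
  have := @conv_diff_ge R A (fun k => - W k) m (fun j => ltW (A_gt0 j)) A_decr.
  rewrite Wm0 oppr0 mulr0 => /(_ _) h.
  rewrite -oppr_ge0 -sumrN (le_trans (h _))//.
    by move=> k _; rewrite oppr_le0 l2norm_ge0.
  by apply: ler_sum => k _; lra.
have Wm : 0 < W m.+1 by rewrite lt_neqAle eq_sym Wm_neq0 l2norm_ge0.
rewrite -(ler_pM2r Wm) mulrBl lerBlDr.
have [_ ufe eqn] := sol.
have m1 : (1 <= m.+1 <= 2 * K * N)%N by [].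
have := eqn m.+1 m1 _ (ufe _ m1).
set I := inner L _ _.
set J := inner L (fun y => _ * _) _.
have IE : I = \sum_(0 <= k < m.+1) A (m - k)%N *
    (inner L (u k.+1%:Z) (u m.+1%:Z) - inner L (u k%:Z) (u m.+1%:Z)).
  rewrite /I DalphaE inner_sum_nat//; last first.
    move=> k /andP[_ km].
    apply/bounded_measurableZ/bounded_measurableB; first exact: buS.
    exact: bu.
  apply: eq_big_nat => k /andP[_ km].
  have uk := bu k km; have uk1 := buS k km.
  by rewrite innerZl ?innerBl//; exact: bounded_measurableB.
have JE : J = \sum_(0 <= k < m.+1) A (m - k)%N *
    (rho * b * inner L (u (k.+1%:Z - (2 * N)%:Z)) (u m.+1%:Z)).
  rewrite /J JdelayE innerZl//; last first.
    apply: bounded_measurable_sum_nat => k /andP[_ km].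
    by apply: bounded_measurableZ; exact: bd.
  rewrite inner_sum_nat//; last first.
    by move=> k /andP[_ km]; apply: bounded_measurableZ; exact: bd.
  rewrite mulr_sumr; apply: eq_big_nat => k /andP[_ km].
  by rewrite innerZl//=; [ring|exact: bd].
have I_ge : (\sum_(0 <= k < m.+1) A (m - k)%N * (W k.+1 - W k)) * W m.+1 <= I.
  rewrite IE mulr_suml -subr_ge0 -sumrB.
  (* [c] is nonpositive by Cauchy-Schwarz and vanishes at [m.+1], so Abel summation allows the inner
     products to be replaced by products of norms. *)
  pose c k := inner L (u k%:Z) (u m.+1%:Z) - W k * W m.+1.
  have := @conv_diff_ge R A c m (fun j => ltW (A_gt0 j)) A_decr.
  rewrite {2}/c inner_self subrr mulr0 => /(_ _) h.
  rewrite (le_trans (h _))//.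
    move=> k km; rewrite subr_le0 inner_cauchy_schwarz//; exact: bu.
  by apply: ler_sum => k _; rewrite /c; lra.
have J_le : J <=
    (\sum_(0 <= k < m.+1) A (m - k)%N * (rho * `|b| * D k.+1)) * W m.+1.
  rewrite JE mulr_suml; apply: ler_sum_nat => k /andP[_ km].
  have /(ler_wpM2l (mulr_ge0 (ltW (A_gt0 (m - k)%N)) (ltW rho0))) :
      b * inner L (u (k.+1%:Z - (2 * N)%:Z)) (u m.+1%:Z) <=
      `|b| * (D k.+1 * W m.+1).
    rewrite (le_trans (ler_norm _))// normrM ler_wpM2l//.
    by apply: norm_inner_le => //; exact: bd.
  by lra.
have G_le : inner L (source alpha f (time tau N m.+1%:Z)) (u m.+1%:Z) <=
    g m.+1 * W m.+1.
  by rewrite inner_cauchy_schwarz//; exact: bounded_measurable_source_sol.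
have := bilin_ge0 _ um.
by move=> *; lra.
Qed.

Lemma l2norm_sol_le n : (0 < K)%N -> (n < 2 * K * N)%N ->
  W n.+1 <= expR (`|b| * (K%:R * tau)) *
    (W 0 + rho * `|b| *
       \sum_(1 <= k < (2 * N).+1) l2norm L (phi (k%:Z - (2 * N)%:Z)) +
     Gamma (2 - alpha) / (1 - alpha) * time tau N n.+1%:Z `^ alpha *
       \big[Num.max/0]_(1 <= j < n.+2) g j).
Proof.
move=> K0 nKN.
have A_gt0 j : 0 < A j by exact: l1coef_gt0.
have A_decr j : A j.+1 <= A j by exact: l1coef_decr.
have rho0 := step_gt0 R tau N tau_gt0 N_gt0.
have alpha1 : 0 < 1 - alpha by rewrite subr_gt0.
have N20 : (0 < 2 * N)%N by rewrite muln_gt0.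
have DW k : D (k + 2 * N)%N = W k by rewrite /D PoszD addrK.
set q := rho * `|b|; have q0 : 0 <= q by rewrite mulr_ge0// ltW.
set Phi := \sum_(_ <= _ < _) _.
set gm := \big[_/_]_(_ <= _ < _) _.
have gm0 : 0 <= gm.
  rewrite /gm; elim/big_ind: _ => // *; rewrite ?le_max; last exact: l2norm_ge0.
  by lra.
have g_le j : (1 <= j < n.+2)%N -> g j <= gm.
  move=> jn; rewrite /gm (bigD1_seq j) ?iota_uniq ?mem_index_iota//=.
  by rewrite le_max lexx.
set E := _ * _ * gm.
have Phi0 : 0 <= Phi by apply: sumr_ge0 => k _; exact: l2norm_ge0.
have E_ge : gm / A n <= E.
  rewrite ler_pdivrMr//.
  have := l1coef_ge R alpha tau N alpha_gt0 alpha_lt1 tau_gt0 N_gt0 Gamma_gt0 n.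
  have E0 : 0 <= E by rewrite !mulr_ge0 ?powR_ge0// ?invr_ge0 ltW.
  move=> /(ler_wpM2l E0); apply: le_trans.
  rewrite /E /time le_eqVlt; apply/orP; left; apply/eqP.
  field; rewrite !gt_eqF// powR_gt0// mulr_gt0//.
have A_noninc := (nonincreasing_seqP A).1 A_decr.
(* This is the hypothesis of the discrete Gronwall inequality, with one constant for all [m]. *)
have step_le m : (m <= n.+1)%N ->
    W m <= (W 0 + q * Phi + E) + q * \sum_(0 <= j < m) W j.
  case: m => [|m] mn.
    have E0 := le_trans (divr_ge0 gm0 (ltW (A_gt0 n))) E_ge.
    by rewrite big_geq// mulr0 addr0 -!addrA lerDl !addr_ge0// mulr_ge0.
  (* The increments of [z] are exactly the factors multiplying the weights in [l2norm_scheme_le],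
     and [z] starts at 0. *)
  pose z k := W k - W 0 - q * \sum_(0 <= j < k) D j.+1.
  have := @conv_diff_comparison R A z gm m A_gt0 A_decr gm0.
  have -> : z 0%N <= 0 by rewrite /z big_geq// mulr0 subrr subr0.
  move=> /(_ isT) zm.
  have {}zm : z m.+1 <= gm / A m.
    apply: zm => i im.
    have in' : (i <= n)%N by exact: leq_trans im mn.
    apply: (@le_trans _ _ (g i.+1)); last exact: g_le.
    apply: le_trans (l2norm_scheme_le i K0 (leq_ltn_trans in' nKN)).
    apply: ler_sum => k _; rewrite /z big_nat_recr//= -/q.
    by rewrite ler_pM2l ?A_gt0//; lra.
  have : gm / A m <= gm / A n.
    by rewrite ler_wpM2l// lef_pV2 ?posrE// A_noninc.
  have := @sum_delayed_le R D (fun k => l2norm L (phi (k%:Z - (2 * N)%:Z))) W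
    (2 * N) m.+1 N20 (fun=> l2norm_ge0 _ _ _) (fun=> l2norm_ge0 _ _ _)
    l2norm_delayed_phi DW.
  move=> /(ler_wpM2l q0); rewrite mulrDr -/Phi.
  by move: zm; rewrite /z; lra.
have B0 : 0 <= W 0 + q * Phi + E.
  have E0 := le_trans (divr_ge0 gm0 (ltW (A_gt0 n))) E_ge.
  by rewrite !addr_ge0// ?l2norm_ge0// mulr_ge0.
(* The growth factor is bounded independently of [N], since 1 + q <= e^q and (n + 1) rho <= K
   tau. *)
apply: (le_trans (discrete_gronwall R W _ q n.+1 B0 q0 step_le)).
rewrite mulrC ler_wpM2r//.
apply: (@le_trans _ _ (expR q ^+ n.+1)).
  by rewrite lerXn2r ?nnegrE ?expR_ge0 ?expR_ge1Dx// addr_ge0.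
rewrite -expRM_natl ler_expR /q mulrA mulrC ler_wpM2l//.
exact: time_le.
Qed.

End Scheme.

(** * A stability constant uniform in the discretization *)

Theorem theorem3p1 (R : realType) (L alpha tau p a b sigma : R) (K : nat)
    (L_gt0 : 0 < L) (alpha_gt0 : 0 < alpha) (alpha_lt1 : alpha < 1)
    (tau_gt0 : 0 < tau) (K_gt0 : (0 < K)%N) (p_gt0 : 0 < p) (a_le0 : a <= 0)
    (b_neq0 : b != 0) (sigma_gt0 : 0 < sigma) :
  exists2 C : R, 0 < C &
    forall (N : nat) (M : nat) (x : nat -> R) (f : R -> R -> R)
      (phi u : int -> R -> R),
    (2 <= N)%N ->
    is_mesh L M x -> quasi_uniform sigma M x ->
    {within `[0, L] `*` `[0, K%:R * tau],
      continuous (fun z : R * R => f z.1 z.2)} ->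
    (forall n : nat, (1 <= n <= 2 * N)%N ->
       fe_space L M x (phi (n%:Z - (2 * N)%:Z))) ->
    fem_solution L alpha tau p a b K N M x f phi u ->
    forall n : nat, (1 <= n <= 2 * K * N)%N ->
      l2norm L (u n%:Z) <=
        C * (l2norm L (u 0)
             + step tau N * `|b| *
               (\sum_(1 <= k < (2 * N).+1)
                  l2norm L (phi (k%:Z - (2 * N)%:Z)))
             + time tau N n%:Z `^ alpha / Gamma (1 + alpha) *
               \big[Num.max/0]_(1 <= j < n.+1)
                 l2norm L (source alpha f (time tau N j%:Z))).
Proof.
have G1 : 0 < Gamma (1 + alpha) by apply: Gamma_gt0; lra.
have G2 : 0 < Gamma (2 - alpha) by apply: Gamma_gt0; lra.
have alpha1 : 0 < 1 - alpha by rewrite subr_gt0.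
(* [kappa] is the ratio between the factor Gamma(2-alpha) / (1-alpha) obtained from the weights and
   the sharp 1 / Gamma(1+alpha); [1 + kappa] dominates both 1 and [kappa], hence all three terms. *)
pose kappa := Gamma (1 + alpha) * (Gamma (2 - alpha) / (1 - alpha)).
have kappa0 : 0 < kappa := mulr_gt0 G1 (divr_gt0 G2 alpha1).
exists (expR (`|b| * (K%:R * tau)) * (1 + kappa)).
  by rewrite mulr_gt0 ?expR_gt0// addr_gt0.
move=> N M x f phi u N2 _ _ cf fe_phi sol [//|n] /andP[_ nKN].
have N0 : (0 < N)%N by exact: ltnW.
have := l2norm_sol_le R L alpha tau p a b K N M x f phi u L_gt0 alpha_gt0
  alpha_lt1 tau_gt0 p_gt0 a_le0 N0 G2 cf fe_phi sol n K_gt0 nKN.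
move=> /le_trans; apply.
rewrite -[leRHS]mulrA ler_wpM2l ?expR_ge0//.
set W0 := l2norm L (u 0); set S := step tau N * _ * _.
set g := \big[_/_]_(_ <= _ < _) _; set t := time _ _ _ `^ _.
have S0 : 0 <= S.
  have rho0 := step_gt0 R tau N tau_gt0 N0.
  apply: mulr_ge0; first exact: mulr_ge0 (ltW rho0) (normr_ge0 b).
  by apply: sumr_ge0 => k _; exact: l2norm_ge0.
have g0 : 0 <= g.
  rewrite /g; elim/big_ind: _ => // *; rewrite ?le_max; last exact: l2norm_ge0.
  by lra.
have W00 : 0 <= W0 by exact: l2norm_ge0.
have -> : Gamma (2 - alpha) / (1 - alpha) * t * g =
    kappa * (t / Gamma (1 + alpha) * g).
  by rewrite /kappa; field; rewrite !gt_eqF.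
have T0 : 0 <= t / Gamma (1 + alpha) * g.
  by rewrite mulr_ge0// divr_ge0 ?powR_ge0// ltW.
by rewrite mulrDl mul1r; have := mulr_ge0 (ltW kappa0) (addr_ge0 W00 S0); lra.
Qed.
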